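(* Let $R$ be an associative ring with identity and let $m,n$ be positive integers with $n\le m$. Then $$m\text{-SG-Proj}(R)\cap n\text{-SG-Proj}(R)=(m,n)\text{-SG-Proj}(R),$$ where $(m,n)$ denotes the greatest common divisor of $m$ and $n$.
   Context: $\mathrm{Mod}\,R$ is the category of left $R$-modules. For a positive integer $n$, a module $M\in \mathrm{Mod}\,R$ is called $n$-strongly Gorenstein projective ($n$-SG-projective) if there exists an exact sequence $0\to M\to P_{n-1}\to\cdots\to P_0\to M\to 0$ in $\mathrm{Mod}\,R$ with $P_i$ projective for all $0\le i\le n-1$, which remains exact after applying $\mathrm{Hom}_R(-,P)$ for every projective $P\in\mathrm{Mod}\,R$. $n\text{-SG-Proj}(R)$ denotes the (full) subcategory of $\mathrm{Mod}\,R$ consisting of all $n$-SG-projective modules. *)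

(* Defs.v *)
From HB Require Import structures.
From mathcomp Require Import all_boot all_order all_algebra.

Set Implicit Arguments.
Unset Strict Implicit.
Unset Printing Implicit Defensive.

Import GRing.Theory.

Local Open Scope ring_scope.

(* [pzRingType] is MathComp's structure of associative unital rings, with the
   zero ring allowed, and [lmodType R] its structure of left R-modules. *)

Definition surj (A B : Type) (f : A -> B) : Prop := forall y, exists x, f x = y.

Definition projective (R : pzRingType) (P : lmodType R) : Prop :=
  forall (A B : lmodType R) (p : {linear A -> B}) (f : {linear P -> B}),
    surj p -> exists g : {linear P -> A}, p \o g =1 f.

(* A finite sequence X_{n+1} -> X_n -> ... -> X_0 is given by nat-indexed
   families [X] and [d], with [d i] going from X_{i+1} to X_i.  Only X_0, ...,
   X_{n+1} and d_0, ..., d_n are constrained; the other terms are junk. *)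

(* 0 -> X_{n+1} -> X_n -> ... -> X_0 -> 0 is exact. *)
Definition exact_seq (R : pzRingType) (n : nat) (X : nat -> lmodType R)
    (d : forall i, {linear X i.+1 -> X i}) : Prop :=
  [/\ injective (d n),
      forall i, (i < n)%N ->
        forall x : X i.+1, d i x = 0 <-> exists y : X i.+2, d i.+1 y = x
    & surj (d 0%N)].

(* 0 -> Hom(X_0, Q) -> Hom(X_1, Q) -> ... -> Hom(X_{n+1}, Q) -> 0 is exact,
   where the i-th map is g |-> g \o d i. *)
Definition hom_exact_seq (R : pzRingType) (n : nat) (X : nat -> lmodType R)
    (d : forall i, {linear X i.+1 -> X i}) (Q : lmodType R) : Prop :=
  [/\ forall f : {linear X 0%N -> Q},
        (forall x, f (d 0%N x) = 0) -> forall x, f x = 0,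
      forall i, (i < n)%N -> forall f : {linear X i.+1 -> Q},
        (forall x, f (d i.+1 x) = 0) <->
        (exists g : {linear X i -> Q}, g \o d i =1 f)
    & forall f : {linear X n.+1 -> Q},
        exists g : {linear X n -> Q}, g \o d n =1 f].

(* Membership in n-SG-Proj(R), meant for n > 0.  The term P_i of the sequence
   0 -> M -> P_{n-1} -> ... -> P_0 -> M -> 0 is [X i.+1]. *)
Definition SG_projective (R : pzRingType) (n : nat) (M : lmodType R) : Prop :=
  exists (X : nat -> lmodType R) (d : forall i, {linear X i.+1 -> X i}),
    [/\ X 0%N = M /\ X n.+1 = M,
        forall i, (i < n)%N -> projective (X i.+1),
        exact_seq n d
      & forall Q : lmodType R, projective Q -> hom_exact_seq n d Q].

(* Main.v *)
Require Import Defs.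
From HB Require Import structures.
From mathcomp Require Import all_boot all_order all_algebra.

(** Call [A] a syzygy of [B] if there is an exact sequence 0 -> A -> P -> B -> 0
    with [P] projective that stays exact under Hom(-, Q) for every projective
    [Q].  Cutting a Hom-exact sequence of projectives at its kernels and gluing
    the pieces back shows that, for n > 0, the module M is n-SG-projective
    exactly when M is an n-fold syzygy of itself ([SG_projectiveP]).  It then
    suffices that S = {n | M is an n-fold syzygy of M} is closed under addition
    and under subtraction: by Bezout, such a set contains gcd(m, n) as soon as
    it contains m and n, and it contains all multiples of its elements.

    Closure under addition is the splicing of sequences ([nsyzygy_cat]).  For
    closure under subtraction, let n + k and n be in S.  Break the longer
    sequence at its n-th syzygy L counted from M on the right, so that M is a
    k-fold syzygy of L and L is an n-fold syzygy of M.  But M is itself an n-fold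
    syzygy of M, hence Schanuel's lemma ([schanuel], iterated in
    [nsyzygy_schanuel]) gives that L and M are stably equivalent, i.e. isomorphic
    up to projective direct summands.  The summands can be absorbed into the
    projective term next to L, so L may be replaced by M in the statement that M
    is a k-fold syzygy of L ([syzygy_stable]): k is in S.  The sequence stays
    Hom-exact because its left end is untouched and its middle term E is a
    submodule of the old one enlarged by a projective: maps from the left end
    extend to the enlarged term, and one restricts them to E. *)

Set Implicit Arguments.
Unset Strict Implicit.
Unset Printing Implicit Defensive.

Import GRing.Theory.

Local Open Scope ring_scope.

(** * Kernels, factorizations and maps into products *)

Definition in_ker (R : pzRingType) (A B : lmodType R) (f : {linear A -> B}) :
  {pred A} := fun x => f x == 0.

Lemma in_ker_submod (R : pzRingType) (A B : lmodType R) (f : {linear A -> B}) :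
  submod_closed (in_ker f).
Proof.
split=> [|a x y]; rewrite !unfold_in /in_ker ?linear0 // linearP.
by move=> /eqP-> /eqP->; rewrite scaler0 addr0.
Qed.

HB.instance Definition _ (R : pzRingType) (A B : lmodType R)
    (f : {linear A -> B}) :=
  GRing.isSubmodClosed.Build R A (in_ker f) (in_ker_submod f).

Record ker (R : pzRingType) (A B : lmodType R) (f : {linear A -> B}) :=
  Ker { ker_val : A; ker_valP : ker_val \in in_ker f }.

HB.instance Definition _ (R : pzRingType) (A B : lmodType R)
    (f : {linear A -> B}) := [isSub for @ker_val R A B f].
HB.instance Definition _ (R : pzRingType) (A B : lmodType R)
    (f : {linear A -> B}) := [Choice of ker f by <:].
HB.instance Definition _ (R : pzRingType) (A B : lmodType R)
    (f : {linear A -> B}) := [SubChoice_isSubLmodule of ker f by <:].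

Definition is_kernel (R : pzRingType) (K A B : lmodType R)
    (k : {linear K -> A}) (f : {linear A -> B}) : Prop :=
  injective k /\ forall x, f x = 0 <-> exists y, k y = x.

Lemma kernel_exists (R : pzRingType) (A B : lmodType R) (f : {linear A -> B}) :
  exists (K : lmodType R) (k : {linear K -> A}), is_kernel k f.
Proof.
exists (ker f), (\val : ker f -> A); split; first exact: val_inj.
move=> x; split=> [/eqP fx0 | [y <-]]; first by exists (Ker (f := f) fx0).
by apply/eqP; exact: (valP y).
Qed.

(** An equation in a module is a boolean predicate on a choice type, so that
    preimages under [k] can be picked without any choice axiom; injectivity
    makes the result linear. *)
Lemma factor_injective (R : pzRingType) (K A C : lmodType R)
    (k : {linear K -> A}) (g : {linear C -> A}) :
  injective k -> (forall c, exists y, k y = g c) ->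
  exists h : {linear C -> K}, forall c, k (h c) = g c.
Proof.
move=> k_inj kg.
have kgb c : exists y, k y == g c by have [y <-] := kg c; exists y.
pose h c := xchoose (kgb c).
have hE c : k (h c) = g c by apply/eqP/(xchooseP (kgb c)).
have h_lin : linear h.
  by move=> a x y; apply: k_inj; rewrite linearP !hE linearP.
pose hL := GRing.isLinear.Build R C K *:%R h h_lin.
by exists (HB.pack_for {linear C -> K} h hL).
Qed.

Lemma kernel_lift (R : pzRingType) (K A B C : lmodType R)
    (k : {linear K -> A}) (f : {linear A -> B}) (g : {linear C -> A}) :
  is_kernel k f -> (forall c, f (g c) = 0) ->
  exists h : {linear C -> K}, forall c, k (h c) = g c.
Proof.
by move=> [k_inj kf] fg0; apply: factor_injective => // c; apply/kf/fg0.
Qed.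

Lemma factor_surjective (R : pzRingType) (A B C : lmodType R)
    (p : {linear A -> B}) (f : {linear A -> C}) :
  surj p -> (forall x, p x = 0 -> f x = 0) ->
  exists g : {linear B -> C}, g \o p =1 f.
Proof.
move=> p_surj f0.
have pb y : exists x, p x == y by have [x <-] := p_surj y; exists x.
pose s y := xchoose (pb y).
have sE y : p (s y) = y by apply/eqP/(xchooseP (pb y)).
have f_eq x y : p x = p y -> f x = f y.
  by move=> pxy; apply: subr0_eq; rewrite -linearB f0 // linearB pxy subrr.
have g_lin : linear (f \o s).
  by move=> a x y /=; rewrite -linearP; apply: f_eq; rewrite linearP !sE.
pose gL := GRing.isLinear.Build R B C *:%R (f \o s) g_lin.
exists (HB.pack_for {linear B -> C} (f \o s) gL) => x /=.
by apply: f_eq; rewrite sE.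
Qed.

Definition pair_map (R : pzRingType) (A B C : lmodType R)
    (f : {linear A -> B}) (g : {linear A -> C}) : A -> B * C :=
  fun x => (f x, g x).

Lemma pair_map_linear (R : pzRingType) (A B C : lmodType R)
    (f : {linear A -> B}) (g : {linear A -> C}) : linear (pair_map f g).
Proof. by move=> a x y; rewrite /pair_map !linearP. Qed.

HB.instance Definition _ (R : pzRingType) (A B C : lmodType R)
    (f : {linear A -> B}) (g : {linear A -> C}) :=
  GRing.isLinear.Build R A (B * C)%type *:%R (pair_map f g)
    (pair_map_linear f g).

(** * Isomorphisms, projective modules and split surjections *)

Definition iso (R : pzRingType) (A B : lmodType R) : Prop :=
  exists (f : {linear A -> B}) (g : {linear B -> A}), cancel f g /\ cancel g f.

Lemma iso_sym (R : pzRingType) (A B : lmodType R) : iso A B -> iso B A.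
Proof. by move=> [f [g [fK gK]]]; exists g, f. Qed.

Lemma iso_trans (R : pzRingType) (A B C : lmodType R) :
  iso A B -> iso B C -> iso A C.
Proof.
move=> [f [g [fK gK]]] [f' [g' [fK' gK']]].
exists (f' \o f), (g \o g').
by split=> x /=; rewrite ?fK' ?fK ?gK ?gK'.
Qed.

Lemma projective_retract (R : pzRingType) (P E : lmodType R)
    (s : {linear E -> P}) (r : {linear P -> E}) :
  projective P -> cancel s r -> projective E.
Proof.
move=> projP sK A B p f p_surj.
have [g gE] := projP A B p (f \o r) p_surj.
by exists (g \o s) => x /=; have /= -> := gE (s x); rewrite sK.
Qed.

Lemma projective_prod (R : pzRingType) (P Q : lmodType R) :
  projective P -> projective Q -> projective (P * Q)%type.
Proof.
move=> projP projQ A B p f p_surj.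
have [g gE] := projP A B p (f \o pair_map idfun \0) p_surj.
have [h hE] := projQ A B p (f \o pair_map \0 idfun) p_surj.
exists ((g \o fst) \+ (h \o snd)) => -[x y] /=.
rewrite linearD; have /= -> := gE x; have /= -> := hE y.
by rewrite -linearD; congr (f _); congr pair; rewrite /= ?addr0 ?add0r.
Qed.

Lemma split_iso (R : pzRingType) (A X V : lmodType R)
    (j : {linear A -> X}) (q : {linear X -> V}) :
  is_kernel j q -> surj q -> projective V -> iso (A * V)%type X.
Proof.
move=> kerj q_surj projV; have [j_inj jq] := kerj.
have [s sE] := projV X V q idfun q_surj.
have qs v : q (s v) = v := sE v.
have qj a : q (j a) = 0 by apply/jq; exists a.
have qr x : q ((idfun \- (s \o q)) x) = 0 by rewrite /= linearB qs subrr.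
have [r rE] := kernel_lift kerj qr.
exists ((j \o fst) \+ (s \o snd)), (pair_map r q).
split=> [[a v]|x] /=; last by rewrite rE /= subrK.
have qav : q (j a + s v) = v by rewrite linearD qj qs add0r.
by congr pair; [apply: j_inj; rewrite rE /= qav addrK | exact: qav].
Qed.

(** * Syzygies and stable equivalence *)

(** The extension property is the one condition that exactness of Hom(-, Q) adds
    for a short exact sequence: Hom(-, Q) is always left exact. *)
Definition syzygy (R : pzRingType) (A B : lmodType R) : Prop :=
  exists (P : lmodType R) (i : {linear A -> P}) (p : {linear P -> B}),
    [/\ projective P, is_kernel i p, surj p
      & forall Q : lmodType R, projective Q ->
        forall f : {linear A -> Q}, exists g : {linear P -> Q}, g \o i =1 f].

Definition stable (R : pzRingType) (A B : lmodType R) : Prop :=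
  exists U V : lmodType R,
    [/\ projective U, projective V & iso (A * U)%type (B * V)%type].

Lemma stable_refl (R : pzRingType) (A : lmodType R) : stable A A.
Proof.
exists 'rV[R]_0, 'rV[R]_0.
have proj0 : projective 'rV[R]_0.
  move=> C B p f _; exists \0 => x /=.
  by rewrite (thinmx0 x) !linear0.
split=> //; by exists idfun, idfun.
Qed.

(** The fibre product of [P] and [P'] over [B] maps onto both factors, with
    kernels [A'] and [A]; both surjections split. *)
Lemma schanuel (R : pzRingType) (A A' B : lmodType R) :
  syzygy A B -> syzygy A' B -> stable A A'.
Proof.
move=> [P [i [p [projP [i_inj ip] p_surj _]]]].
move=> [P' [i' [p' [projP' [i'_inj ip'] p'_surj _]]]].
have pi a : p (i a) = 0 by apply/ip; exists a.
have pi' a : p' (i' a) = 0 by apply/ip'; exists a.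
pose e : {linear (P * P')%type -> B} := (p \o fst) \- (p' \o snd).
have [X [k kerk]] := kernel_exists e; have [k_inj ke] := kerk.
have eq_p x : p (k x).1 = p' (k x).2.
  by apply/eqP; rewrite -subr_eq0; apply/eqP/ke; exists x.
have e_j a : e (pair_map i \0 a) = 0 by rewrite /e /= pi linear0 subrr.
have e_j' a : e (pair_map \0 i' a) = 0 by rewrite /e /= pi' linear0 subrr.
have [j jE] := kernel_lift kerk e_j.
have [j' jE'] := kernel_lift kerk e_j'.
exists P', P; split=> //.
apply: (@iso_trans _ _ X).
- apply: (@split_iso _ _ _ _ j (snd \o k)) => //.
    split=> [a b /(congr1 k)|x]; first by rewrite !jE => -[/i_inj].
    split=> [/= kx0|[a <-]]; last by rewrite /= jE.
    have /ip[a ia] : p (k x).1 = 0 by rewrite eq_p kx0 linear0.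
    by exists a; apply: k_inj; rewrite jE /= /pair_map ia /= -kx0; case: (k x).
  move=> y; have [x pxy] := p_surj (p' y).
  have /ke[z kz] : e (x, y) = 0 by rewrite /e /= pxy subrr.
  by exists z; rewrite /= kz.
- apply/iso_sym/(@split_iso _ _ _ _ j' (fst \o k)) => //.
    split=> [a b /(congr1 k)|x]; first by rewrite !jE' => -[/i'_inj].
    split=> [/= kx0|[a <-]]; last by rewrite /= jE'.
    have /ip'[a ia] : p' (k x).2 = 0 by rewrite -eq_p kx0 linear0.
    by exists a; apply: k_inj; rewrite jE' /= /pair_map ia /= -kx0; case: (k x).
  move=> x; have [y pxy] := p'_surj (p x).
  have /ke[z kz] : e (x, y) = 0 by rewrite /e /= pxy subrr.
  by exists z; rewrite /= kz.
Qed.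

(** From 0 -> A -> P -> B -> 0 and B + U = B' + V one gets a surjection from
    P + U onto B' + V; the kernel [E] of its component in [V] is a direct summand
    of P + U, and it is the middle term of the sequence ending in [B']. *)
Lemma syzygy_stable (R : pzRingType) (A B B' : lmodType R) :
  syzygy A B -> stable B B' -> syzygy A B'.
Proof.
move=> [P [i [p [projP [i_inj ip] p_surj ext]]]].
move=> [U [V [projU projV [phi [psi [phiK psiK]]]]]].
pose w : {linear (P * U)%type -> (B * U)%type} := pair_map (p \o fst) snd.
have w_surj y : exists x, phi (w x) = y.
  have [x px] := p_surj (psi y).1.
  exists (x, (psi y).2).
  by rewrite /w /= /pair_map /= px -surjective_pairing psiK.
pose q : {linear (P * U)%type -> V} := snd \o (phi \o w).
have [E [k kerk]] := kernel_exists q; have [k_inj kq] := kerk.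
have q_surj : surj q.
  by move=> v; have [x wx] := w_surj (0, v); exists x; rewrite /= wx.
have qk z : (phi (w (k z))).2 = 0 by apply/kq; exists z.
have pi a : p (i a) = 0 by apply/ip; exists a.
have wi a : w (pair_map i \0 a) = 0 by rewrite /w /= /pair_map /= pi.
have q_i a : q (pair_map i \0 a) = 0 by rewrite /q /= wi linear0.
have [i' iE'] := kernel_lift kerk q_i.
exists E, i', (fst \o (phi \o (w \o k))); split.
- have [f [g [fK gK]]] := split_iso kerk q_surj projV.
  have projPU : projective (P * U)%type by exact: projective_prod.
  pose s : {linear E -> (P * U)%type} := f \o pair_map idfun \0.
  apply: (projective_retract (s := s) (r := fst \o g) projPU).
  by move=> x /=; rewrite fK.
- split=> [a b /(congr1 k)|z]; first by rewrite !iE' => -[/i_inj].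
  split=> [/= z0|[a <-]]; last by rewrite /= iE' wi linear0.
  have wz0 : w (k z) = 0.
    rewrite -[w _]phiK; have := qk z; move: z0.
    by case: (phi _) => /= b v -> ->; rewrite (linear0 psi).
  have /ip[a ia] : p (k z).1 = 0 by have /(congr1 fst) := wz0.
  exists a; apply: k_inj; rewrite iE' /= /pair_map ia /=.
  by have /(congr1 snd) := wz0; case: (k z) => ? ? /= ->.
- move=> b; have [x wx] := w_surj (b, 0).
  have /kq[z kz] : q x = 0 by rewrite /q /= wx.
  by exists z; rewrite /= kz wx.
- move=> Q projQ f; have [g gE] := ext Q projQ f.
  by exists (g \o (fst \o k)) => a /=; rewrite iE'; apply: gE.
Qed.

(** * Iterated syzygies *)

Fixpoint nsyzygy (R : pzRingType) (n : nat) (A B : lmodType R) : Prop :=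
  if n is n'.+1 then exists C, syzygy C B /\ nsyzygy n' A C else A = B.

Lemma nsyzygy_cat (R : pzRingType) (m n : nat) (A C : lmodType R) :
  nsyzygy (m + n) A C <-> exists B, nsyzygy m A B /\ nsyzygy n B C.
Proof.
elim: n C => [|n IHn] C.
  by rewrite addn0; split=> [?|[B [? <-]]]; first exists C.
rewrite addnS /=; split=> [[D [DC /IHn[B [AB BD]]]]|[B [AB [D [DC BD]]]]].
  by exists B; split=> //; exists D.
by exists D; split=> //; apply/IHn; exists B.
Qed.

Lemma nsyzygy_schanuel (R : pzRingType) (n : nat) (A A' B : lmodType R) :
  nsyzygy n A B -> nsyzygy n A' B -> stable A A'.
Proof.
(* The ends must be allowed to differ by a stable equivalence, since that is all
   Schanuel's lemma leaves after one step. *)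
suff gen B' : stable B B' -> nsyzygy n A B -> nsyzygy n A' B' -> stable A A'.
  exact/gen/stable_refl.
elim: n B B' => [|n IHn] B B' BB' /=; first by move=> -> ->.
move=> [C [CB chA]] [C' [CB' chA']]; apply: IHn chA chA'.
exact: schanuel (syzygy_stable CB BB') CB'.
Qed.

Lemma nsyzygy_stable (R : pzRingType) (n : nat) (A B B' : lmodType R) :
  nsyzygy n.+1 A B -> stable B B' -> nsyzygy n.+1 A B'.
Proof.
by move=> [C [CB chA]] BB'; exists C; split=> //; apply: syzygy_stable CB BB'.
Qed.

Lemma nsyzygy_self_add (R : pzRingType) (m n : nat) (M : lmodType R) :
  nsyzygy m M M -> nsyzygy n M M -> nsyzygy (m + n) M M.
Proof. by move=> mM nM; apply/nsyzygy_cat; exists M. Qed.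

Lemma nsyzygy_self_mul (R : pzRingType) (k n : nat) (M : lmodType R) :
  nsyzygy n M M -> nsyzygy (k * n) M M.
Proof.
by move=> nM; elim: k => // k IHk; rewrite mulSn; apply: nsyzygy_self_add.
Qed.

Lemma nsyzygy_self_cancel (R : pzRingType) (k n : nat) (M : lmodType R) :
  nsyzygy (k + n) M M -> nsyzygy n M M -> nsyzygy k M M.
Proof.
case: k => // k /nsyzygy_cat[L [ML LM]] nM.
exact: nsyzygy_stable ML (nsyzygy_schanuel LM nM).
Qed.

Lemma nsyzygy_self_gcd (R : pzRingType) (m n : nat) (M : lmodType R) :
  (0 < m)%N -> nsyzygy m M M -> nsyzygy n M M -> nsyzygy (gcdn m n) M M.
Proof.
move=> m_gt0 mM nM; have [u v uvE _] := egcdnP n m_gt0.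
apply: (@nsyzygy_self_cancel _ _ (v * n)); last exact: nsyzygy_self_mul.
by rewrite addnC -uvE; apply: nsyzygy_self_mul.
Qed.

(** * Hom-exact sequences as chains of syzygies *)

(** The sequence is cut at the kernels of its maps.  The extension property of
    the piece ending in ker d_k comes from Hom-exactness one place further left:
    a map from that kernel to [Q], precomposed with d_(k+1), is a cocycle. *)
Lemma exact_nsyzygy (R : pzRingType) (n : nat) (X : nat -> lmodType R)
    (d : forall i, {linear X i.+1 -> X i}) :
  (forall i, (i < n)%N -> projective (X i.+1)) -> exact_seq n d ->
  (forall Q : lmodType R, projective Q -> hom_exact_seq n d Q) ->
  (0 < n)%N -> nsyzygy n (X n.+1) (X 0%N).
Proof.
move=> projX [dn_inj d_ex d0_surj] homX.
(* [K] is any copy of ker d_k, so that [X n.+1] itself can be used for the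
   leftmost kernel. *)
have chain k (K : lmodType R) (j : {linear K -> X k.+1}) :
    (k < n)%N -> is_kernel j (d k) ->
    (forall Q : lmodType R, projective Q -> forall f : {linear K -> Q},
       exists g : {linear X k.+1 -> Q}, g \o j =1 f) ->
  nsyzygy k.+1 K (X 0%N).
  elim: k K j => [|k IHk] K j lt_kn kerj ext.
    exists K; split=> //; exists (X 1%N), j, (d 0%N); split=> //.
    exact: projX.
  have [K' [j' kerj']] := kernel_exists (d k); have [j'_inj j'd] := kerj'.
  have dd x : d k (d k.+1 x) = 0 by apply/(d_ex k (ltnW lt_kn)); exists x.
  have [e eE] := kernel_lift kerj' dd.
  have e_surj : surj e.
    move=> y; have : d k (j' y) = 0 by apply/j'd; exists y.
    move=> /(d_ex k (ltnW lt_kn))[x dx].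
    by exists x; apply: j'_inj; rewrite eE.
  rewrite -addn1 addnC; apply/nsyzygy_cat; exists K'; split.
    exists K; split=> //; exists (X k.+2), j, e; split=> //; first exact: projX.
    have [j_inj jd] := kerj; split=> // x; split=> [ex0|/jd dx0].
      by apply/jd; rewrite -eE ex0 linear0.
    by apply: j'_inj; rewrite eE dx0 linear0.
  apply: (IHk K' j') => // [|Q projQ f]; first exact: ltnW.
  have [_ hom_ex _] := homX Q projQ.
  have fe_cocycle x : (f \o e) (d k.+2 x) = 0.
    suff -> : (f \o e) (d k.+2 x) = f 0 by rewrite linear0.
    congr (f _); apply: j'_inj; rewrite eE linear0.
    by apply/(d_ex k.+1 lt_kn); exists x.
  have [g gE] := (hom_ex k.+1 lt_kn (f \o e)).1 fe_cocycle.
  exists g => y; have [x <-] := e_surj y.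
  by rewrite -[RHS]gE /= eE.
case: n => // n in projX dn_inj d_ex homX chain * => _.
apply: (chain n _ (d n.+1)) => // [|Q projQ f].
  by split=> // x; apply: d_ex.
by have [_ _] := homX Q projQ; apply.
Qed.

(** Splicing from the right end: the differential from X_1 to the new term [P] is
    the composite X_1 -> C -> P, and a map on X_1 that factors through [C]
    extends to [P] by the extension property of 0 -> C -> P -> B -> 0. *)
Lemma nsyzygy_exact (R : pzRingType) (n : nat) (A B : lmodType R) :
  nsyzygy n A B ->
  exists (X : nat -> lmodType R) (d : forall i, {linear X i.+1 -> X i}),
    [/\ X 0%N = B /\ X n.+1 = A,
        forall i, (i < n)%N -> projective (X i.+1),
        exact_seq n d
      & forall Q : lmodType R, projective Q -> hom_exact_seq n d Q].
Proof.
elim: n B => [|n IHn] B /=.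
  move=> <-; exists (fun=> A), (fun=> idfun); split=> //.
    by split=> // y; exists y.
  by move=> Q _; split=> // f; exists f.
move=> [C [[P [i [p [projP [i_inj ip] p_surj ext]]]] /IHn]].
move=> [X [d [[X0 Xn] projX [dn_inj d_ex d0_surj] homX]]]; subst C.
pose Y k : lmodType R :=
  match k with 0 => B | 1 => P | k'.+2 => X k'.+1 end.
pose e k : {linear Y k.+1 -> Y k} :=
  match k with 0 => p | 1 => i \o d 0%N | k'.+2 => d k'.+1 end.
exists Y, e; split=> //.
- by case=> // k; apply: projX.
- split=> //; first by case: (n) dn_inj => //= d0_inj x y /i_inj /d0_inj.
  case=> [_ x|[|k] lt_kn x] //=; last exact: d_ex.
    split=> [/ip[y <-]|[y <-]]; last by apply/ip; exists (d 0%N y).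
    by have [z <-] := d0_surj y; exists z.
  split=> [idx0|/(d_ex 0%N lt_kn) -> ]; last by rewrite linear0.
  by apply/(d_ex 0%N lt_kn)/i_inj; rewrite linear0.
- move=> Q projQ; have [hom_inj hom_ex hom_surj] := homX Q projQ; split.
  + by move=> f fp0 y; have [x <-] := p_surj y; apply: fp0.
  + case=> [_ f|[|k] lt_kn f] /=; last exact: hom_ex.
      split=> [fid0|[g gE] x]; last first.
        by rewrite -[LHS]gE /= (ip _).2 ?linear0 //; exists (d 0%N x).
      apply: factor_surjective => // x /ip[y <-].
      by have [z <-] := d0_surj y; apply: fid0.
    split=> [/(hom_ex 0%N lt_kn)[g gE]|[g gE]].
      have [h hE] := ext Q projQ g; exists h => x.
      by rewrite -[RHS]gE /= -[RHS]hE.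
    by apply/(hom_ex 0%N lt_kn); exists (g \o i).
  + case: (n) hom_surj => [|k] hom_surj f; last exact: hom_surj.
    have [g gE] := hom_surj f; have [h hE] := ext Q projQ g.
    by exists h => x; rewrite -[RHS]gE /= -[RHS]hE.
Qed.

Lemma SG_projectiveP (R : pzRingType) (n : nat) (M : lmodType R) :
  (0 < n)%N -> SG_projective n M <-> nsyzygy n M M.
Proof.
move=> n_gt0; split=> [[X [d [[X0 Xn] projX d_ex homX]]]|/nsyzygy_exact //].
by rewrite -{1}Xn -X0; apply: exact_nsyzygy d_ex homX n_gt0.
Qed.

Theorem theorem3p5 (R : pzRingType) (m n : nat)
    (m_gt0 : (0 < m)%N) (n_gt0 : (0 < n)%N) (le_nm : (n <= m)%N)
    (M : lmodType R) :
  SG_projective m M /\ SG_projective n M <-> SG_projective (gcdn m n) M.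
Proof.
have gcd_gt0 : (0 < gcdn m n)%N by rewrite gcdn_gt0 m_gt0.
split=> [[/SG_projectiveP-/(_ m_gt0) mM /SG_projectiveP-/(_ n_gt0) nM]|].
  by apply/SG_projectiveP => //; apply: nsyzygy_self_gcd.
move=> /SG_projectiveP-/(_ gcd_gt0) dM.
split; apply/SG_projectiveP => //.
  by rewrite -(divnK (dvdn_gcdl m n)); apply: nsyzygy_self_mul.
by rewrite -(divnK (dvdn_gcdr m n)); apply: nsyzygy_self_mul.
Qed.
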